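(* Let $(\mathcal{J}_1,\bullet_1,B)$ be a pseudo-euclidean mock-Lie superalgebra, $(\mathcal{J}_2,\bullet_2)$ a mock-Lie superalgebra, and $\phi:\mathcal{J}_2\to\mathfrak{AnDer}_s(\mathcal{J}_1)$ a representation of mock-Lie superalgebras. Let $\varphi:\mathcal{J}_1\times\mathcal{J}_1\to\mathcal{J}_2^*$ be the even bilinear map defined by $\varphi(x,y)(a)=(-1)^{|x|(|y|+|a|)}B(y,\phi(a)(x))$ for all homogeneous $x,y\in\mathcal{J}_1$, $a\in\mathcal{J}_2$. Then $\mathcal{J}=\mathcal{J}_2\oplus\mathcal{J}_1\oplus\mathcal{J}_2^*$ is a mock-Lie superalgebra with the product $$(a+x+f)\bullet_d(b+y+g)=a\bullet_2b+x\bullet_1y+\phi(a)(y)+(-1)^{|x||y|}\phi(b)(x)+L_2^*(a)(g)+(-1)^{|x||y|}L_2^*(b)(f)+\varphi(x,y)$$ for all homogeneous $a+x+f,\ b+y+g\in\mathcal{J}_2\oplus\mathcal{J}_1\oplus\mathcal{J}_2^*$ (so $|a|=|x|=|f|$ and $|b|=|y|=|g|$), where $L_2^*$ is the coadjoint representation of $\mathcal{J}_2$.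
   Context: All vector spaces are finite-dimensional over a field $\mathbb{K}$ of characteristic $0$; $|x|$ denotes the degree of a homogeneous element $x$ of a $\mathbb{Z}_2$-graded space; dual spaces carry the natural grading. A mock-Lie superalgebra is a $\mathbb{Z}_2$-graded vector space $\mathcal{J}$ with an even bilinear product $\bullet$ (i.e. $\mathcal{J}_i\bullet\mathcal{J}_j\subset\mathcal{J}_{i+j}$) such that for all homogeneous $x,y,z$: $x\bullet y=(-1)^{|x||y|}y\bullet x$, and $(-1)^{|x||z|}x\bullet(y\bullet z)+(-1)^{|x||y|}y\bullet(z\bullet x)+(-1)^{|y||z|}z\bullet(x\bullet y)=0$. It is pseudo-euclidean if it is equipped with a bilinear form $B$ that is even ($B(\mathcal{J}_{\bar0},\mathcal{J}_{\bar1})=B(\mathcal{J}_{\bar1},\mathcal{J}_{\bar0})=0$), supersymmetric ($B(x,y)=(-1)^{|x||y|}B(y,x)$), non-degenerate and invariant ($B(x\bullet y,z)=B(x,y\bullet z)$). An anti-superderivation of degree $\alpha$ of $\mathcal{J}$ is $D\in\mathrm{End}(\mathcal{J})_\alpha$ with $D(x\bullet y)=-D(x)\bullet y-(-1)^{\alpha|x|}x\bullet D(y)$. It is supersymmetric with respect to $B$ if $B(D(x),y)=(-1)^{\alpha|x|}B(x,D(y))$ for all homogeneous $x$ and all $y$; $\mathfrak{AnDer}_s(\mathcal{J})$ is the graded space of supersymmetric anti-superderivations. A representation of $\mathcal{J}$ on a $\mathbb{Z}_2$-graded space $\mathcal{V}$ is an even linear map $\pi:\mathcal{J}\to\mathrm{End}(\mathcal{V})$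 with $\pi(x\bullet y)=-\pi(x)\pi(y)-(-1)^{|x||y|}\pi(y)\pi(x)$ for homogeneous $x,y$. That $\phi:\mathcal{J}_2\to\mathfrak{AnDer}_s(\mathcal{J}_1)$ is a representation means it is a representation of $\mathcal{J}_2$ on the graded space $\mathcal{J}_1$ whose values are in $\mathfrak{AnDer}_s(\mathcal{J}_1)$. The coadjoint representation is $L_2^*:\mathcal{J}_2\to\mathrm{End}(\mathcal{J}_2^* )$, $L_2^*(a)(f)=(-1)^{|f||a|}f\circ L_2(a)$, where $L_2(a)(b)=a\bullet_2b$. *)

(* Defs.v *)
From HB Require Import structures.
From mathcomp Require Import all_boot all_order all_algebra.

Set Implicit Arguments.
Unset Strict Implicit.
Unset Printing Implicit Defensive.

Import GRing.Theory.
Local Open Scope ring_scope.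

(* Z_2 is bool: false is the even degree, i (+) j is the sum of degrees and
   i && j their product, so that (-1)^{|x||y|} reads (-1) ^+ (i && j).
   A vector is homogeneous of degree i when it lies in G i; the zero vector
   is thus homogeneous of both degrees.
   A bilinear map U x V -> W is an element of 'Hom(U, 'Hom(V, W)). *)

Section Gradings.
Variable K : fieldType.

Definition is_grading (V : vectType K) (G : bool -> {vspace V}) : Prop :=
  (G false + G true = fullv)%VS /\ (G false :&: G true = 0)%VS.

Definition even_bilinear (U V W : vectType K) (GU : bool -> {vspace U})
    (GV : bool -> {vspace V}) (GW : bool -> {vspace W})
    (m : 'Hom(U, 'Hom(V, W))) : Prop :=
  forall (i j : bool) (x : U) (y : V),
    x \in GU i -> y \in GV j -> m x y \in GW (i (+) j).

Definition homogeneous_end (V : vectType K) (G : bool -> {vspace V})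
    (alpha : bool) (D : 'End(V)) : Prop :=
  forall (i : bool) (x : V), x \in G i -> D x \in G (alpha (+) i).

Definition dual (V : vectType K) : vectType K := 'Hom(V, K^o).

(* The degree i part of the dual consists of the forms that vanish on the
   part of the other degree, see memv_dual_grading. *)
Definition dual_grading (V : vectType K) (G : bool -> {vspace V})
    (i : bool) : {vspace dual V} :=
  lker (linfun (fun f : dual V => (f \o projv (G (~~ i)))%VF : dual V)).

Definition prod_grading (U V : vectType K) (GU : bool -> {vspace U})
    (GV : bool -> {vspace V}) (i : bool) : {vspace (U * V)%type} :=
  (linfun (@fst U V) @^-1: GU i :&: linfun (@snd U V) @^-1: GV i)%VS.

Lemma memv_dual_grading (V : vectType K) (G : bool -> {vspace V}) (i : bool)
    (f : dual V) :
  reflect (forall x, x \in G (~~ i) -> f x = 0) (f \in dual_grading G i).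
Proof.
pose h (f : dual V) : dual V := (f \o projv (G (~~ i)))%VF.
have hlin : linear h.
  by move=> k u v; rewrite /h comp_lfunDl comp_lfunZl.
pose hM := GRing.isLinear.Build K (dual V) (dual V) _ h hlin.
pose hL : {linear dual V -> dual V} := HB.pack h hM.
rewrite /dual_grading memv_ker -[fun _ => _]/(hL : _ -> _) lfunE /=.
apply: (iffP eqP) => [f0 x Gx | f0].
  by have /lfunP/(_ x) := f0; rewrite comp_lfunE projv_id // lfunE.
by apply/lfunP=> x; rewrite comp_lfunE lfunE /= f0 ?memv_proj.
Qed.

Lemma memv_prod_grading (U V : vectType K) (GU : bool -> {vspace U})
    (GV : bool -> {vspace V}) (i : bool) (u : U * V) :
  (u \in prod_grading GU GV i) = (u.1 \in GU i) && (u.2 \in GV i).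
Proof. by rewrite memv_cap -!memv_preim !lfunE. Qed.

End Gradings.

Section MockLie.
Variable K : fieldType.

Definition mock_lie_superalgebra (J : vectType K) (G : bool -> {vspace J})
    (mul : 'Hom(J, 'End(J))) : Prop :=
  [/\ is_grading G,
      even_bilinear G G G mul,
      forall (i j : bool) (x y : J), x \in G i -> y \in G j ->
        mul x y = (-1) ^+ (i && j) *: mul y x
    & forall (i j k : bool) (x y z : J), x \in G i -> y \in G j -> z \in G k ->
        (-1) ^+ (i && k) *: mul x (mul y z)
        + (-1) ^+ (i && j) *: mul y (mul z x)
        + (-1) ^+ (j && k) *: mul z (mul x y) = 0].

Definition pseudo_euclidean (J : vectType K) (G : bool -> {vspace J})
    (mul : 'Hom(J, 'End(J))) (B : 'Hom(J, dual J)) : Prop :=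
  [/\ forall (i : bool) (x y : J), x \in G i -> y \in G (~~ i) -> B x y = 0,
      forall (i j : bool) (x y : J), x \in G i -> y \in G j ->
        B x y = (-1) ^+ (i && j) *: B y x,
      forall x : J, (forall y : J, B x y = 0) -> x = 0
    & forall x y z : J, B (mul x y) z = B x (mul y z)].

Definition anti_superderivation (J : vectType K) (G : bool -> {vspace J})
    (mul : 'Hom(J, 'End(J))) (alpha : bool) (D : 'End(J)) : Prop :=
  homogeneous_end G alpha D /\
  forall (i : bool) (x y : J), x \in G i ->
    D (mul x y) = - mul (D x) y - (-1) ^+ (alpha && i) *: mul x (D y).

Definition supersymmetric_end (J : vectType K) (G : bool -> {vspace J})
    (B : 'Hom(J, dual J)) (alpha : bool) (D : 'End(J)) : Prop :=
  forall (i : bool) (x y : J), x \in G i ->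
    B (D x) y = (-1) ^+ (alpha && i) *: B x (D y).

Definition in_AnDer_s (J : vectType K) (G : bool -> {vspace J})
    (mul : 'Hom(J, 'End(J))) (B : 'Hom(J, dual J)) (D : 'End(J)) : Prop :=
  exists2 Dh : bool -> 'End(J),
    D = Dh false + Dh true
    & forall alpha : bool, anti_superderivation G mul alpha (Dh alpha) /\
                           supersymmetric_end G B alpha (Dh alpha).

Definition representation (J V : vectType K) (GJ : bool -> {vspace J})
    (mul : 'Hom(J, 'End(J))) (GV : bool -> {vspace V})
    (rho : 'Hom(J, 'End(V))) : Prop :=
  (forall (i : bool) (x : J), x \in GJ i -> homogeneous_end GV i (rho x)) /\
  forall (i j : bool) (x y : J), x \in GJ i -> y \in GJ j ->
    rho (mul x y) =
      - (rho x \o rho y)%VF - (-1) ^+ (i && j) *: (rho y \o rho x)%VF.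

Definition is_coadjoint (J : vectType K) (G : bool -> {vspace J})
    (mul : 'Hom(J, 'End(J))) (Ls : 'Hom(J, 'End(dual J))) : Prop :=
  forall (i j : bool) (a : J) (f : dual J),
    a \in G i -> f \in dual_grading G j ->
    Ls a f = (-1) ^+ (j && i) *: (f \o mul a)%VF.

End MockLie.

Section DoubleExtension.
Variables (K : fieldType) (J1 J2 : vectType K).
Variables (G1 : bool -> {vspace J1}) (G2 : bool -> {vspace J2}).

Definition is_cocycle_form (B : 'Hom(J1, dual J1)) (phi : 'Hom(J2, 'End(J1)))
    (vphi : 'Hom(J1, 'Hom(J1, dual J2))) : Prop :=
  even_bilinear G1 G1 (dual_grading G2) vphi /\
  forall (i j k : bool) (x y : J1) (a : J2),
    x \in G1 i -> y \in G1 j -> a \in G2 k ->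
    vphi x y a = (-1) ^+ (i && (j (+) k)) *: B y (phi a x).

(* (a, x, f) stands for a + x + f. *)
Definition double_ext : vectType K := (J2 * J1 * dual J2)%type.

Definition double_ext_grading : bool -> {vspace double_ext} :=
  prod_grading (prod_grading G2 G1) (dual_grading G2).

Definition is_double_ext_product (mul1 : 'Hom(J1, 'End(J1)))
    (mul2 : 'Hom(J2, 'End(J2))) (phi : 'Hom(J2, 'End(J1)))
    (Ls : 'Hom(J2, 'End(dual J2))) (vphi : 'Hom(J1, 'Hom(J1, dual J2)))
    (d : 'Hom(double_ext, 'End(double_ext))) : Prop :=
  forall (i j : bool) (a b : J2) (x y : J1) (f g : dual J2),
    ((a, x, f) : double_ext) \in double_ext_grading i ->
    ((b, y, g) : double_ext) \in double_ext_grading j ->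
    d (a, x, f) (b, y, g) =
      (mul2 a b,
       mul1 x y + phi a y + (-1) ^+ (i && j) *: phi b x,
       Ls a g + (-1) ^+ (i && j) *: Ls b f + vphi x y).

End DoubleExtension.

(* Main.v *)
(* Every phi a with a homogeneous is a supersymmetric anti-superderivation of
   degree |a|, because the even and odd components of phi a are separated by the
   grading.  The J2-component of the Jacobi identity is the one of J2; the
   J1-component is the one of J1 plus terms cancelled by the representation and
   derivation laws.  Evaluated at e in J2, the dual component splits into the
   coadjoint representation law, the terms B(z, phi(a) phi(e) y) coming from
   both L_2^* varphi and varphi(_, phi _), which cancel by supersymmetry of phi,
   and the cyclic sum of varphi(x, yz)(e), which vanishes because phi e is a
   supersymmetric anti-superderivation and B is invariant.  After reduction to
   such normal forms only signs remain, checked on all parities. *)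
Require Import Defs.
From HB Require Import structures.
From mathcomp Require Import all_boot all_order all_algebra.
From mathcomp Require Import ring.
Import GRing.Theory.
Local Open Scope ring_scope.

Set Implicit Arguments.
Unset Strict Implicit.
Unset Printing Implicit Defensive.

(** * Linear algebra of spaces graded by Z_2 *)

Section GradedSpaces.
Context {K : fieldType}.

Lemma linfun_of (U V : vectType K) (m : U -> V) :
  linear m -> exists h : 'Hom(U, V), forall x, h x = m x.
Proof.
move=> mlin; pose mM := GRing.isLinear.Build K U V _ m mlin.
pose mL : {linear U -> V} := HB.pack m mM.
by exists (linfun mL) => x; rewrite lfunE.
Qed.

Lemma bilinfun_of (U V W : vectType K) (m : U -> V -> W) :
  (forall x, linear (m x)) -> (forall y, linear (m^~ y)) ->
  exists h : 'Hom(U, 'Hom(V, W)), forall x y, h x y = m x y.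
Proof.
move=> mr ml.
pose mM x := GRing.isLinear.Build K V W _ (m x) (mr x).
pose row x := linfun (HB.pack_for {linear V -> W} (m x) (mM x)).
have rowE x y : row x y = m x y by rewrite lfunE.
have [|h hE] := @linfun_of U 'Hom(V, W) row.
  by move=> k x x'; apply/lfunP=> y; rewrite !lfunE /= !lfunE /= !rowE ml.
by exists h => x y; rewrite hE rowE.
Qed.

Lemma grading_intro (V : vectType K) (G : bool -> {vspace V}) :
  (forall x, exists x0 x1, [/\ x0 \in G false, x1 \in G true & x = x0 + x1]) ->
  (forall x, x \in G false -> x \in G true -> x = 0) -> is_grading G.
Proof.
move=> split disj; split; apply/vspaceP=> x.
  by rewrite memvf; have [x0 [x1 [? ? ->]]] := split x; apply: memv_add.
rewrite memv_cap memv0; apply/andP/eqP => [[]|->]; first exact: disj.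
by rewrite !mem0v.
Qed.

(** The kernel of the projection matters: [daddv_pi] projects along the other graded part, whereas
    [projv] projects along a complement unrelated to the grading. *)
Definition gproj (V : vectType K) (G : bool -> {vspace V}) (i : bool) : 'End(V) :=
  daddv_pi (G i) (G (~~ i)).

Section Projections.
Variables (V : vectType K) (G : bool -> {vspace V}).
Hypothesis gradG : is_grading G.

Lemma grading_cap0 i : (G i :&: G (~~ i) = 0)%VS.
Proof. by case: gradG => _; case: i => //=; rewrite capvC. Qed.

Lemma memv_gproj i x : gproj G i x \in G i.
Proof. exact: memv_pi. Qed.

Lemma gproj_id i x : x \in G i -> gproj G i x = x.
Proof. by move=> Gx; rewrite /gproj daddv_pi_id ?grading_cap0. Qed.

Lemma gproj_sum x : x = gproj G false x + gproj G true x.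
Proof.
case: gradG => GT G0; by rewrite /gproj daddv_pi_add // GT memvf.
Qed.

Lemma gproj_other i x : x \in G i -> gproj G (~~ i) x = 0.
Proof.
move=> Gx; have := gproj_sum x; case: i Gx => Gx; rewrite (gproj_id Gx) => e.
  by apply: (addIr x); rewrite add0r.
by apply: (addrI x); rewrite addr0.
Qed.

Lemma grading_disjoint i x : x \in G i -> x \in G (~~ i) -> x = 0.
Proof.
by move=> xi xi'; rewrite -(gproj_id xi) -[i in gproj G i]negbK gproj_other.
Qed.

Lemma grading_ind (P : V -> Prop) :
  (forall x y, P x -> P y -> P (x + y)) ->
  (forall i x, x \in G i -> P x) -> forall x, P x.
Proof.
by move=> PD PG x; rewrite (gproj_sum x); apply: PD; apply: PG (memv_gproj _ _).
Qed.

End Projections.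

Lemma lfun_eq_graded (V W : vectType K) (G : bool -> {vspace V}) (f g : 'Hom(V, W)) :
  is_grading G -> (forall i x, x \in G i -> f x = g x) -> f = g.
Proof.
move=> gradG fg; apply/lfunP; apply: (grading_ind gradG) fg => x y fx fy.
by rewrite !linearD /= fx fy.
Qed.

(** A form splits by precomposition with the two projections, since [f \o gproj G i] kills the part
    of the other degree. A form homogeneous of both degrees vanishes on both parts, hence
    everywhere. *)
Lemma dual_grading_is_grading (V : vectType K) (G : bool -> {vspace V}) :
  is_grading G -> is_grading (dual_grading G).
Proof.
move=> gradG; apply: grading_intro => f.
  exists (f \o gproj G false)%VF, (f \o gproj G true)%VF.
  split; last by apply/lfunP=> x; rewrite !lfunE /= !lfunE /= -linearD -gproj_sum.
    apply/memv_dual_grading=> x Gx; rewrite lfunE /=.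
    by rewrite (@gproj_other _ _ gradG true) ?linear0.
  apply/memv_dual_grading=> x Gx; rewrite lfunE /=.
  by rewrite (@gproj_other _ _ gradG false) ?linear0.
move=> /memv_dual_grading f1 /memv_dual_grading f0.
apply: (lfun_eq_graded gradG) => -[] x Gx; rewrite lfunE; [exact: f1|exact: f0].
Qed.

Lemma prod_grading_is_grading (U V : vectType K) (GU : bool -> {vspace U})
    (GV : bool -> {vspace V}) :
  is_grading GU -> is_grading GV -> is_grading (prod_grading GU GV).
Proof.
move=> gradU gradV; apply: grading_intro => [[x y]|[x y]].
  exists (gproj GU false x, gproj GV false y), (gproj GU true x, gproj GV true y).
  split; rewrite ?memv_prod_grading ?memv_gproj //.
  by rewrite [in LHS](gproj_sum gradU x) [in LHS](gproj_sum gradV y).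
rewrite !memv_prod_grading /= => /andP[x0 y0] /andP[x1 y1].
by rewrite (grading_disjoint gradU x0 x1) (grading_disjoint gradV y0 y1).
Qed.

(** Formulas with signs depend on the degrees of the arguments and so make sense only on homogeneous
    vectors. Summing the formula over the components of both arguments extends it to a bilinear
    map. *)
Lemma graded_bilinear (U V W : vectType K) (GU : bool -> {vspace U})
    (GV : bool -> {vspace V}) (m : bool -> bool -> U -> V -> W) :
  is_grading GU -> is_grading GV ->
  (forall i j x, linear (m i j x)) -> (forall i j y, linear ((m i j)^~ y)) ->
  exists h : 'Hom(U, 'Hom(V, W)),
    forall i j x y, x \in GU i -> y \in GV j -> h x y = m i j x y.
Proof.
move=> gradU gradV mr ml.
have [h hE] : exists h : 'Hom(U, 'Hom(V, W)), forall x y,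
    h x y = \sum_i \sum_j m i j (gproj GU i x) (gproj GV j y).
  apply: bilinfun_of => [x k y y'|y k x x'];
    rewrite scaler_sumr -big_split; apply: eq_bigr => i _ /=;
    rewrite scaler_sumr -big_split; apply: eq_bigr => j _ /=.
  - by rewrite linearP mr.
  - by rewrite linearP ml.
have m0 i j x : m i j x 0 = 0.
  by have := mr i j x (-1) 0 0; rewrite scaler0 addr0 scaleN1r addNr.
have m0l i j y : m i j 0 y = 0.
  by have := ml i j y (-1) 0 0; rewrite scaler0 addr0 scaleN1r addNr.
(* For homogeneous [x] and [y] only the summand of index [(i, j)] survives: every other one has a
   zero projection as an argument and vanishes by [m0] or [m0l]. *)
exists h => i j x y xi yj; rewrite hE.
rewrite (bigD1 i) //= (bigD1 j) //= (gproj_id gradU xi) (gproj_id gradV yj).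
rewrite !big1 ?addr0 // => [i' ne|j' ne].
  rewrite big1 // => j' _.
  by rewrite (_ : i' = ~~ i) ?(gproj_other gradU xi) //; case: i i' ne {xi} => [] [].
by rewrite (_ : j' = ~~ j) ?(gproj_other gradV yj) //; case: j j' ne {yj} => [] [].
Qed.
(** On [x] of degree [j], both [D x] and [Dh i x] have degree [i (+) j], so their difference
    [Dh (~~ i) x] has this degree as well as the opposite one, and is zero. *)
Lemma homogeneous_component (V : vectType K) (G : bool -> {vspace V}) (D : 'End(V))
    (Dh : bool -> 'End(V)) i :
  is_grading G -> (forall j, homogeneous_end G j (Dh j)) ->
  D = Dh false + Dh true -> homogeneous_end G i D -> D = Dh i.
Proof.
move=> gradG DhG defD DG; apply: (lfun_eq_graded gradG) => j x xj.
have DE : D x = Dh i x + Dh (~~ i) x.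
  by rewrite defD lfunE /=; case: {DG} i => //=; rewrite addrC.
have D0 : Dh (~~ i) x = 0.
  apply: (grading_disjoint gradG (i := i (+) j)).
    by rewrite -[_ x](addKr (Dh i x)) -DE rpredD ?rpredN ?DhG ?DG.
  by rewrite -addNb DhG.
by rewrite DE D0 addr0.
Qed.

(** * Evaluation rules for linear and bilinear forms *)

Lemma formD (V : vectType K) (f : dual V) x y : f (x + y) = f x + f y :> K.
Proof. by rewrite linearD. Qed.
Lemma formN (V : vectType K) (f : dual V) x : f (- x) = - f x :> K.
Proof. by rewrite linearN. Qed.
Lemma formZ (V : vectType K) (f : dual V) c x : f (c *: x) = c * f x :> K.
Proof. by rewrite linearZ. Qed.
Lemma dualD (V : vectType K) (f g : dual V) x : (f + g) x = f x + g x :> K.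
Proof. by rewrite lfunE. Qed.
Lemma dualZ (V : vectType K) c (f : dual V) x : (c *: f) x = c * f x :> K.
Proof. by rewrite lfunE. Qed.
Lemma biformDl (U V : vectType K) (C : 'Hom(U, dual V)) x y z :
  C (x + y) z = C x z + C y z :> K.
Proof. by rewrite linearD dualD. Qed.
Lemma biformNl (U V : vectType K) (C : 'Hom(U, dual V)) x z :
  C (- x) z = - C x z :> K.
Proof. by rewrite -scaleN1r linearZ dualZ mulN1r. Qed.
Lemma biformZl (U V : vectType K) (C : 'Hom(U, dual V)) c x z :
  C (c *: x) z = c * C x z :> K.
Proof. by rewrite linearZ dualZ. Qed.

Lemma dual_compE (U V : vectType K) (f : dual V) (g : 'Hom(U, V)) x :
  (f \o g)%VF x = f (g x) :> K.
Proof. by rewrite lfunE. Qed.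

(** These rules are typed in [K] rather than [K^o], and scaling is read as multiplication: an
    evaluated identity of forms becomes a goal for [ring]. *)
Definition formE :=
  (dual_compE, formD, formN, formZ, dualD, dualZ, biformDl, biformNl, biformZl).

Lemma homD (U V : vectType K) (h : 'Hom(U, V)) x y : h (x + y) = h x + h y.
Proof. exact: linearD. Qed.
Lemma homZ (U V : vectType K) (h : 'Hom(U, V)) c x : h (c *: x) = c *: h x.
Proof. exact: linearZ. Qed.
Lemma homP (U V : vectType K) (h : 'Hom(U, V)) c x y :
  h (c *: x + y) = c *: h x + h y.
Proof. exact: linearP. Qed.
Lemma hom2P (U V W : vectType K) (h : 'Hom(U, 'Hom(V, W))) c x y z :
  h (c *: x + y) z = c *: h x z + h y z.
Proof. by rewrite linearP !lfunE /= !lfunE. Qed.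

Lemma dual_eqP (V : vectType K) (f g : dual V) :
  (forall x, f x = g x :> K) -> f = g.
Proof. by move=> fg; apply/lfunP. Qed.

End GradedSpaces.

(** * Existence of the coadjoint action, of the form [vphi] and of the product *)

Section DoubleExtensionTheory.
Context {K : fieldType} {J1 J2 : vectType K}.
Context {G1 : bool -> {vspace J1}} {G2 : bool -> {vspace J2}}.
Context {mul1 : 'Hom(J1, 'End(J1))} {mul2 : 'Hom(J2, 'End(J2))}.
Context {B : 'Hom(J1, dual J1)} {phi : 'Hom(J2, 'End(J1))}.

Lemma coadjoint_exists : is_grading G2 ->
  exists Ls : 'Hom(J2, 'End(dual J2)), is_coadjoint G2 mul2 Ls.
Proof.
move=> grad2.
apply: (graded_bilinear (m := fun i j a (f : dual J2) =>
          (-1) ^+ (j && i) *: (f \o mul2 a)%VF : dual J2)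
          grad2 (dual_grading_is_grading grad2)) => [i j a c f g|i j f c a b].
  by apply: dual_eqP => e; rewrite !formE; ring.
apply: dual_eqP => e; rewrite !formE (hom2P mul2) !formE; ring.
Qed.

(** Evenness follows from the formula for the values: if [a] has degree opposite to [i (+) j], then
    [phi a x] has degree opposite to that of [y], and [B] pairs them to zero. *)
Lemma cocycle_form_even (vphi : 'Hom(J1, 'Hom(J1, dual J2))) :
  (forall i x y, x \in G1 i -> y \in G1 (~~ i) -> B x y = 0) ->
  (forall i a, a \in G2 i -> homogeneous_end G1 i (phi a)) ->
  (forall (i j k : bool) (x y : J1) (a : J2),
    x \in G1 i -> y \in G1 j -> a \in G2 k ->
    vphi x y a = (-1) ^+ (i && (j (+) k)) *: B y (phi a x)) ->
  is_cocycle_form G1 G2 B phi vphi.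
Proof.
move=> Beven phiG vphiE; split=> // i j x y xi yj.
apply/memv_dual_grading => a ak; rewrite (vphiE _ _ _ _ _ _ xi yj ak).
rewrite (Beven _ _ _ yj) ?scaler0 //; have := phiG _ _ ak _ _ xi.
by case: (i) (j) => [] [].
Qed.

Lemma cocycle_form_exists :
  is_grading G1 -> is_grading G2 ->
  (forall i x y, x \in G1 i -> y \in G1 (~~ i) -> B x y = 0) ->
  (forall i a, a \in G2 i -> homogeneous_end G1 i (phi a)) ->
  exists vphi : 'Hom(J1, 'Hom(J1, dual J2)), is_cocycle_form G1 G2 B phi vphi.
Proof.
move=> grad1 grad2 Beven phiG.
(* Exchanging the arguments of [phi] makes [phi a x] a linear map of [a], which can be composed with
   [B y] to give a form on [J2]. *)
have [pt ptE] : exists pt : 'Hom(J1, 'Hom(J2, J1)), forall x a, pt x a = phi a x.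
  apply: bilinfun_of => [x c a b|a c x y]; last by rewrite linearP.
  by rewrite linearP !lfunE /= !lfunE.
(* The sign depends on the degree of the argument [a] too, so the form is built separately on each
   graded part of [J2]; the sum over [k] is the value of [vphi]. *)
pose form i j (x y : J1) k : dual J2 :=
  (-1) ^+ (i && (j (+) k)) *: (B y \o (pt x \o gproj G2 k))%VF.
have [||vphi vphiE] := graded_bilinear
  (m := fun i j x y => form i j x y false + form i j x y true) grad1 grad1.
- by move=> i j x c y z; apply: dual_eqP => e; rewrite !formE; ring.
- move=> i j y c x z; apply: dual_eqP => e; rewrite !formE !lfunE /= linearP /=.
  by rewrite ![in LHS]lfunE /= ![in LHS]lfunE /= !formE; ring.
exists vphi; apply: cocycle_form_even => // i j k x y a xi yj ak.
rewrite (vphiE _ _ _ _ xi yj) /form !lfunE /= !lfunE /= !lfunE /= !lfunE /= !ptE.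
case: k ak => ak; rewrite (gproj_id grad2 ak).
  by rewrite (@gproj_other _ _ _ grad2 true) // !linear0 lfunE /= !linear0 add0r.
by rewrite (@gproj_other _ _ _ grad2 false) // !linear0 lfunE /= !linear0 addr0.
Qed.

Hypotheses (mockJ1 : mock_lie_superalgebra G1 mul1)
  (pseudoJ1 : pseudo_euclidean G1 mul1 B)
  (mockJ2 : mock_lie_superalgebra G2 mul2)
  (phi_AnDer : forall a : J2, in_AnDer_s G1 mul1 B (phi a))
  (phi_rep : representation G2 mul2 G1 phi).
Variables (Ls : 'Hom(J2, 'End(dual J2))) (vphi : 'Hom(J1, 'Hom(J1, dual J2))).
Hypotheses (LsP : is_coadjoint G2 mul2 Ls) (vphiP : is_cocycle_form G1 G2 B phi vphi).

Let grad1 : is_grading G1. Proof. by case: mockJ1. Qed.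
Let grad2 : is_grading G2. Proof. by case: mockJ2. Qed.

Lemma double_ext_product_exists :
  exists d : 'Hom(double_ext J1 J2, 'End(double_ext J1 J2)),
    is_double_ext_product G1 G2 mul1 mul2 phi Ls vphi d.
Proof.
have gradD : is_grading (double_ext_grading G1 G2).
  exact: prod_grading_is_grading (prod_grading_is_grading grad2 grad1)
           (dual_grading_is_grading grad2).
have [||d dE] := graded_bilinear
  (m := fun i j (u v : double_ext J1 J2) =>
    ((mul2 u.1.1 v.1.1,
      mul1 u.1.2 v.1.2 + phi u.1.1 v.1.2 + (-1) ^+ (i && j) *: phi v.1.1 u.1.2,
      Ls u.1.1 v.2 + (-1) ^+ (i && j) *: Ls v.1.1 u.2 + vphi u.1.2 v.1.2)
      : double_ext J1 J2)) gradD gradD.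
- move=> i j [[a x] f] c [[b y] g] [[b' y'] g']; congr (_, _, _) => /=.
  + by rewrite homP.
  + rewrite (hom2P phi) !homP !scalerDr !scalerA ![c * _]mulrC.
    by rewrite [X in X + _ = _]addrACA [LHS]addrACA.
  + by apply: dual_eqP => e; rewrite (hom2P Ls) !homP !formE; ring.
- move=> i j [[b y] g] c [[a x] f] [[a' x'] f']; congr (_, _, _) => /=.
  + by rewrite (hom2P mul2).
  + rewrite (hom2P mul1) (hom2P phi) !homP !scalerDr !scalerA ![c * _]mulrC.
    by rewrite [X in X + _ = _]addrACA [LHS]addrACA.
  + by apply: dual_eqP => e; rewrite (hom2P Ls) (hom2P vphi) !homP !formE; ring.
by exists d => i j a b x y f g ui vj; rewrite (dE _ _ _ _ ui vj).
Qed.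

(** * Parity and sign rules for the two products, [phi] and [Ls] *)

Let mul1_even i j x y : x \in G1 i -> y \in G1 j -> mul1 x y \in G1 (i (+) j).
Proof. by case: mockJ1 => _ + _ _; apply. Qed.
Let mul2_even i j a b : a \in G2 i -> b \in G2 j -> mul2 a b \in G2 (i (+) j).
Proof. by case: mockJ2 => _ + _ _; apply. Qed.
Let phi_even i j a x : a \in G2 i -> x \in G1 j -> phi a x \in G1 (i (+) j).
Proof. by case: phi_rep => + _ ai; move/(_ _ _ ai); apply. Qed.
Let mul1C i j x y : x \in G1 i -> y \in G1 j ->
  mul1 x y = (-1) ^+ (i && j) *: mul1 y x.
Proof. by case: mockJ1 => _ _ + _; apply. Qed.
Let mul2C i j a b : a \in G2 i -> b \in G2 j ->
  mul2 a b = (-1) ^+ (i && j) *: mul2 b a.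
Proof. by case: mockJ2 => _ _ + _; apply. Qed.

Lemma Ls_val i j a f e : a \in G2 i -> f \in dual_grading G2 j ->
  Ls a f e = (-1) ^+ (j && i) * f (mul2 a e) :> K.
Proof. by move=> ai fj; rewrite (LsP ai fj) !formE. Qed.

Lemma Ls_even i j a f : a \in G2 i -> f \in dual_grading G2 j ->
  Ls a f \in dual_grading G2 (i (+) j).
Proof.
move=> ai fj; apply/memv_dual_grading => e ek; rewrite (Ls_val _ ai fj).
move/memv_dual_grading: fj => ->; first by rewrite mulr0.
by have := mul2_even ai ek; rewrite addbN addKb.
Qed.

(** Membership in [in_AnDer_s] provides only some splitting into an even and an odd part; the
    representation makes [phi a] homogeneous of degree [i], which identifies it with the part of
    that degree. *)
Lemma phi_homogeneous i a : a \in G2 i ->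
  anti_superderivation G1 mul1 i (phi a) /\ supersymmetric_end G1 B i (phi a).
Proof.
move=> ai; have [Dh defD DhP] := phi_AnDer a.
have -> := homogeneous_component (i := i) grad1 _ defD; first exact: DhP.
  by move=> j; case: (DhP j) => -[].
by case: phi_rep => + _; apply.
Qed.

Lemma phi_sym k i a x y : a \in G2 k -> x \in G1 i ->
  B (phi a x) y = (-1) ^+ (k && i) * B x (phi a y) :> K.
Proof. by move=> /phi_homogeneous[_ sym] xi; rewrite (sym _ _ _ xi). Qed.

Lemma phi_mul2 i j a b x : a \in G2 i -> b \in G2 j ->
  phi (mul2 a b) x = - phi a (phi b x) - (-1) ^+ (i && j) *: phi b (phi a x).
Proof.
move=> ai bj; case: phi_rep => _ /(_ _ _ _ _ ai bj) ->.
by rewrite !lfunE /= !lfunE /= !lfunE /= !lfunE.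
Qed.

(** Normal form of the derivation law: supercommutativity puts the factor hit by [phi a] on the
    right in both terms. *)
Lemma phi_mul1 k i j a x y : a \in G2 k -> x \in G1 i -> y \in G1 j ->
  phi a (mul1 x y) = - ((-1) ^+ ((k (+) i) && j) *: mul1 y (phi a x))
                     - (-1) ^+ (k && i) *: mul1 x (phi a y).
Proof.
move=> ak xi yj; have [[_ der] _] := phi_homogeneous ak.
by rewrite (der _ _ _ xi) (mul1C (phi_even ak xi) yj).
Qed.

(** The Jacobi identity says that left multiplication is a representation of [J2]; composed with
    [f], this yields the representation law for [Ls]. *)
Lemma form_mul2_mul2 i j k (f : dual J2) a b e :
  a \in G2 i -> b \in G2 j -> e \in G2 k ->
  f (mul2 (mul2 a b) e) =
    - f (mul2 a (mul2 b e)) - (-1) ^+ (i && j) * f (mul2 b (mul2 a e)) :> K.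
Proof.
move=> ai bj ek; case: mockJ2 => _ _ _ /(_ _ _ _ _ _ _ ai bj ek)/(congr1 f) jac.
rewrite (mul2C ek ai) (mul2C ek (mul2_even ai bj)) !linearZ /= !formE linear0 in jac.
apply/eqP; rewrite -subr_eq0; apply/eqP.
(* Once [e] is moved to the right, [f (mul2 (mul2 a b) e)] occurs in [jac] with total sign
   [(-1) ^+ (i && k)]; multiplying by this sign makes its coefficient 1. *)
rewrite -[RHS](mulr0 ((-1) ^+ (i && k))) -jac.
by case: (i) (j) (k) => [] [] []; ring.
Qed.

(** * The Jacobi identity in the component [J1] *)

Local Notation prod1 i j a x b y :=
  (mul1 x y + phi a y + (-1) ^+ (i && j) *: phi b x).
Local Notation prod_dual i j a x f b y g :=
  (Ls a g + (-1) ^+ (i && j) *: Ls b f + vphi x y).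

Lemma prod1_jacobi i j k a b c x y z :
  a \in G2 i -> b \in G2 j -> c \in G2 k ->
  x \in G1 i -> y \in G1 j -> z \in G1 k ->
  (-1) ^+ (i && k) *: prod1 i (j (+) k) a x (mul2 b c) (prod1 j k b y c z)
  + (-1) ^+ (i && j) *: prod1 j (k (+) i) b y (mul2 c a) (prod1 k i c z a x)
  + (-1) ^+ (j && k) *: prod1 k (i (+) j) c z (mul2 a b) (prod1 i j a x b y) = 0.
Proof.
move=> ai bj ck xi yj zk.
(* Nondegeneracy serves to turn an identity of vectors into one of scalars [B _ w], which [ring] can
   decide. *)
case: pseudoJ1 => _ _ nondeg _; apply: nondeg => w.
rewrite (phi_mul2 _ ai bj) (phi_mul2 _ bj ck) (phi_mul2 _ ck ai).
rewrite !homD !homZ.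
rewrite (phi_mul1 ai yj zk) (phi_mul1 bj zk xi) (phi_mul1 ck xi yj) !formE.
(* The Jacobi sum of [J1] paired with [w] takes the place of the zero on the right and absorbs the
   terms free of [phi]. *)
case: mockJ1 => _ _ _ /(_ _ _ _ _ _ _ xi yj zk)/(congr1 (fun u => B u w)) jac.
rewrite linear0 lfunE in jac; rewrite -[RHS]jac !formE.
by case: (i) (j) (k) => [] [] []; ring.
Qed.

(** * Values of [Ls] and [vphi], and the Jacobi identity in the dual component *)

Lemma vphi_val i j k x y e : x \in G1 i -> y \in G1 j -> e \in G2 k ->
  vphi x y e = (-1) ^+ (i && (j (+) k)) * B y (phi e x) :> K.
Proof. by case: vphiP => _ /[apply] /[apply] /[apply]. Qed.

Lemma vphi_even i j x y : x \in G1 i -> y \in G1 j ->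
  vphi x y \in dual_grading G2 (i (+) j).
Proof. by case: vphiP => + _; apply. Qed.

Let B_sym i j x y : x \in G1 i -> y \in G1 j ->
  B x y = (-1) ^+ (i && j) * B y x :> K.
Proof. by case: pseudoJ1 => _ + _ _; apply. Qed.

Lemma Ls_Ls_val i j k l a b h e :
  a \in G2 i -> b \in G2 j -> h \in dual_grading G2 k -> e \in G2 l ->
  Ls a (Ls b h) e =
    (-1) ^+ ((j (+) k) && i) * (-1) ^+ (k && j) * h (mul2 b (mul2 a e)) :> K.
Proof.
by move=> ai bj hk el; rewrite (Ls_val _ ai (Ls_even bj hk)) (Ls_val _ bj hk) mulrA.
Qed.

Lemma Ls_mul2_val i j k l a b f e :
  a \in G2 i -> b \in G2 j -> f \in dual_grading G2 k -> e \in G2 l ->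
  Ls (mul2 a b) f e = (-1) ^+ (k && (i (+) j)) *
    (- f (mul2 a (mul2 b e)) - (-1) ^+ (i && j) * f (mul2 b (mul2 a e))) :> K.
Proof.
move=> ai bj fk el.
by rewrite (Ls_val _ (mul2_even ai bj) fk) (form_mul2_mul2 _ ai bj el).
Qed.

(** The representation law for [phi (mul2 a e)] produces both orders of [phi a] and [phi e]; each
    cancels against one term of the form [vphi _ (phi a _)]. *)
Lemma Ls_vphi_val i j k l a x y e :
  a \in G2 i -> x \in G1 j -> y \in G1 k -> e \in G2 l ->
  Ls a (vphi x y) e =
    (-1) ^+ ((j (+) k) && i) * (-1) ^+ (j && (k (+) (i (+) l))) *
    (- B y (phi a (phi e x)) - (-1) ^+ (i && l) * B y (phi e (phi a x))) :> K.
Proof.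
move=> ai xj yk el; rewrite (Ls_val _ ai (vphi_even xj yk)).
by rewrite (vphi_val xj yk (mul2_even ai el)) (phi_mul2 _ ai el) !formE mulrA.
Qed.

(* The same value is read in two ways because the cocycle terms of the Jacobi
   sum cancel in pairs only after moving phi across B. *)
Lemma vphi_phi_val i j k l a x y e :
  a \in G2 i -> x \in G1 j -> y \in G1 k -> e \in G2 l ->
  vphi x (phi a y) e =
    (-1) ^+ (j && (i (+) k (+) l)) * (-1) ^+ (i && k) * B y (phi a (phi e x)) :> K.
Proof.
move=> ai xj yk el; rewrite (vphi_val xj (phi_even ai yk) el).
by rewrite (phi_sym _ ai yk) mulrA.
Qed.

Lemma vphi_phi_val_swap i j k l a x y e :
  a \in G2 i -> x \in G1 j -> y \in G1 k -> e \in G2 l ->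
  vphi x (phi a y) e =
    (-1) ^+ (j && (i (+) k (+) l)) * (-1) ^+ ((i (+) k) && (l (+) j)) *
    (-1) ^+ (l && j) * B x (phi e (phi a y)) :> K.
Proof.
move=> ai xj yk el; rewrite (vphi_val xj (phi_even ai yk) el).
by rewrite (B_sym (phi_even ai yk) (phi_even el xj)) (phi_sym _ el xj) !mulrA.
Qed.

(** Supersymmetry of [B] exchanges [y] and [phi e x], and that of [phi e] then carries it over to
    [y]. *)
Lemma vphiC i j x y : x \in G1 i -> y \in G1 j ->
  vphi x y = (-1) ^+ (i && j) *: vphi y x.
Proof.
move=> xi yj; apply: (lfun_eq_graded grad2) => k e ek; rewrite formE.
rewrite (vphi_val xi yj ek) (vphi_val yj xi ek).
rewrite (B_sym yj (phi_even ek xi)) (phi_sym _ ek xi).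
by case: (i) (j) (k) => [] [] []; ring.
Qed.

Lemma vphi_mul1_jacobi i j k l x y z e :
  x \in G1 i -> y \in G1 j -> z \in G1 k -> e \in G2 l ->
  (-1) ^+ (i && k) * vphi x (mul1 y z) e
  + (-1) ^+ (i && j) * vphi y (mul1 z x) e
  + (-1) ^+ (j && k) * vphi z (mul1 x y) e = 0 :> K.
Proof.
move=> xi yj zk el.
have inv u v w : B (mul1 u v) w = B u (mul1 v w) by case: pseudoJ1.
rewrite (vphi_val xi (mul1_even yj zk) el) (vphi_val yj (mul1_even zk xi) el).
rewrite (vphi_val zk (mul1_even xi yj) el).
have ex := phi_even el xi; have ey := phi_even el yj.
(* The third pairing is a combination of the other two: [phi e] is moved onto [mul1 x y], expanded
   by the derivation law, and invariance regroups the products as [mul1 y z] and [mul1 z x]. *)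
have -> : B (mul1 x y) (phi e z) =
    (-1) ^+ (l && (i (+) j)) *
    (- ((-1) ^+ ((l (+) i) && j) * (-1) ^+ (j && (l (+) i)) *
        (-1) ^+ ((l (+) i) && (j (+) k)) * B (mul1 y z) (phi e x))
     - (-1) ^+ (l && i) * (-1) ^+ (i && (l (+) j)) *
       (-1) ^+ ((l (+) j) && (i (+) k)) * (-1) ^+ (i && k) *
       B (mul1 z x) (phi e y)) :> K.
  have -> : B (mul1 x y) (phi e z) =
      (-1) ^+ (l && (i (+) j)) * B (phi e (mul1 x y)) z :> K.
    by rewrite (phi_sym _ el (mul1_even xi yj)) mulrA -signr_addb addbb mul1r.
  rewrite (phi_mul1 el xi yj) (mul1C yj ex) (mul1C xi ey) !formE ![in LHS]inv.
  rewrite (B_sym ex (mul1_even yj zk)) (B_sym ey (mul1_even xi zk)).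
  rewrite (mul1C xi zk) !formE; congr (_ * _); ring.
by case: (i) (j) (k) (l) => [] [] [] []; ring.
Qed.

Lemma prod_dual_jacobi i j k a b c x y z f g h :
  a \in G2 i -> b \in G2 j -> c \in G2 k ->
  x \in G1 i -> y \in G1 j -> z \in G1 k ->
  f \in dual_grading G2 i -> g \in dual_grading G2 j -> h \in dual_grading G2 k ->
  (-1) ^+ (i && k) *: prod_dual i (j (+) k) a x f
      (mul2 b c) (prod1 j k b y c z) (prod_dual j k b y g c z h)
  + (-1) ^+ (i && j) *: prod_dual j (k (+) i) b y g
      (mul2 c a) (prod1 k i c z a x) (prod_dual k i c z h a x f)
  + (-1) ^+ (j && k) *: prod_dual k (i (+) j) c z h
      (mul2 a b) (prod1 i j a x b y) (prod_dual i j a x f b y g) = 0.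
Proof.
move=> ai bj ck xi yj zk fi gj hk.
apply: (lfun_eq_graded grad2) => l e el; rewrite !homD !homZ !formE.
rewrite (Ls_Ls_val ai bj hk el) (Ls_Ls_val ai ck gj el).
rewrite (Ls_Ls_val bj ck fi el) (Ls_Ls_val bj ai hk el).
rewrite (Ls_Ls_val ck ai gj el) (Ls_Ls_val ck bj fi el).
(* Each of [f], [g], [h] is now evaluated only at nested products ending in [e], in the two orders
   that the iterated [Ls] terms also give. *)
rewrite (Ls_mul2_val bj ck fi el) (Ls_mul2_val ck ai gj el) (Ls_mul2_val ai bj hk el).
rewrite (Ls_vphi_val ai yj zk el) (Ls_vphi_val bj zk xi el) (Ls_vphi_val ck xi yj el).
(* For each of [a], [b], [c], one value is read directly and the other swapped, so that both match
   the two terms of the corresponding [Ls_vphi_val]. *)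
rewrite (vphi_phi_val_swap bj xi zk el) (vphi_phi_val ck xi yj el).
rewrite (vphi_phi_val_swap ck yj xi el) (vphi_phi_val ai yj zk el).
rewrite (vphi_phi_val_swap ai zk yj el) (vphi_phi_val bj zk xi el).
rewrite lfunE -[RHS](vphi_mul1_jacobi xi yj zk el).
by case: (i) (j) (k) (l) => [] [] [] []; ring.
Qed.

(** * The mock-Lie laws on the whole double extension *)

Let mem_double_ext i (a : J2) (x : J1) (f : dual J2) :
  (((a, x, f) : double_ext J1 J2) \in double_ext_grading G1 G2 i) =
  [&& a \in G2 i, x \in G1 i & f \in dual_grading G2 i].
Proof. by rewrite !memv_prod_grading /= andbA. Qed.

Lemma double_ext_mock_lie (d : 'Hom(double_ext J1 J2, 'End(double_ext J1 J2))) :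
  is_double_ext_product G1 G2 mul1 mul2 phi Ls vphi d ->
  mock_lie_superalgebra (double_ext_grading G1 G2) d.
Proof.
move=> dE.
(* Evenness comes first because [dE] describes [d] on homogeneous vectors only: the outer products
   in the Jacobi sum can be expanded once the inner ones are known to be homogeneous. *)
have deven : even_bilinear (double_ext_grading G1 G2) (double_ext_grading G1 G2)
    (double_ext_grading G1 G2) d.
  move=> i j [[a x] f] [[b y] g] ui vj; rewrite (dE _ _ _ _ _ _ _ _ ui vj).
  move: ui vj; rewrite !mem_double_ext => /and3P[ai xi fi] /and3P[bj yj gj].
  have phib := phi_even bj xi; have Lsb := Ls_even bj fi.
  rewrite addbC in phib Lsb; rewrite (mul2_even ai bj) /=; apply/andP; split.
    by rewrite !rpredD ?rpredZ ?(mul1_even xi yj) ?(phi_even ai yj).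
  by rewrite !rpredD ?rpredZ ?(Ls_even ai gj) ?(vphi_even xi yj).
split=> //.
- exact: prod_grading_is_grading (prod_grading_is_grading grad2 grad1)
           (dual_grading_is_grading grad2).
- move=> i j [[a x] f] [[b y] g] ui vj.
  rewrite (dE _ _ _ _ _ _ _ _ ui vj) (dE _ _ _ _ _ _ _ _ vj ui).
  move: ui vj; rewrite !mem_double_ext => /and3P[ai xi fi] /and3P[bj yj gj].
  congr (_, _, _) => /=; first exact: mul2C.
    rewrite !scalerDr scalerA [j && i]andbC -signr_addb addbb scale1r.
    by rewrite (mul1C xi yj) -!addrA [X in _ + X]addrC.
  rewrite !scalerDr scalerA [j && i]andbC -signr_addb addbb scale1r.
  by rewrite (vphiC xi yj) [X in X + _]addrC.
- move=> i j k [[a x] f] [[b y] g] [[c z] h] ui vj wk.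
  rewrite (dE _ _ _ _ _ _ _ _ vj wk) (dE _ _ _ _ _ _ _ _ wk ui).
  rewrite (dE _ _ _ _ _ _ _ _ ui vj).
  have := deven _ _ _ _ vj wk; have := deven _ _ _ _ wk ui.
  have := deven _ _ _ _ ui vj.
  rewrite (dE _ _ _ _ _ _ _ _ vj wk) (dE _ _ _ _ _ _ _ _ wk ui).
  rewrite (dE _ _ _ _ _ _ _ _ ui vj) => uv wu vw.
  rewrite (dE _ _ _ _ _ _ _ _ ui vw) (dE _ _ _ _ _ _ _ _ vj wu).
  rewrite (dE _ _ _ _ _ _ _ _ wk uv).
  move: ui vj wk; rewrite !mem_double_ext.
  move=> /and3P[ai xi fi] /and3P[bj yj gj] /and3P[ck zk hk].
  congr (_, _, _) => /=.
  + by case: mockJ2 => _ _ _; apply.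
  + exact: prod1_jacobi.
  + exact: prod_dual_jacobi.
Qed.

End DoubleExtensionTheory.

Theorem theorem4p3 (K : fieldType) (charK : [pchar K] =i pred0)
  (J1 J2 : vectType K)
  (G1 : bool -> {vspace J1}) (G2 : bool -> {vspace J2})
  (mul1 : 'Hom(J1, 'End(J1))) (mul2 : 'Hom(J2, 'End(J2)))
  (B : 'Hom(J1, dual J1)) (phi : 'Hom(J2, 'End(J1)))
  (mockJ1 : mock_lie_superalgebra G1 mul1)
  (pseudoJ1 : pseudo_euclidean G1 mul1 B)
  (mockJ2 : mock_lie_superalgebra G2 mul2)
  (phi_AnDer : forall a : J2, in_AnDer_s G1 mul1 B (phi a))
  (phi_rep : representation G2 mul2 G1 phi) :
  [/\ exists Ls : 'Hom(J2, 'End(dual J2)), is_coadjoint G2 mul2 Ls,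
      exists vphi : 'Hom(J1, 'Hom(J1, dual J2)),
        is_cocycle_form G1 G2 B phi vphi
    & forall (Ls : 'Hom(J2, 'End(dual J2)))
             (vphi : 'Hom(J1, 'Hom(J1, dual J2))),
        is_coadjoint G2 mul2 Ls -> is_cocycle_form G1 G2 B phi vphi ->
        (exists d : 'Hom(double_ext J1 J2, 'End(double_ext J1 J2)),
           is_double_ext_product G1 G2 mul1 mul2 phi Ls vphi d) /\
        (forall d : 'Hom(double_ext J1 J2, 'End(double_ext J1 J2)),
           is_double_ext_product G1 G2 mul1 mul2 phi Ls vphi d ->
           mock_lie_superalgebra (double_ext_grading G1 G2) d)].
Proof.
have [[grad1 _ _ _] [grad2 _ _ _]] := (mockJ1, mockJ2).
split; first exact: coadjoint_exists.
  by case: pseudoJ1 phi_rep => Beven _ _ _ [phiG _]; apply: cocycle_form_exists.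
move=> Ls vphi LsP vphiP; split; first exact: double_ext_product_exists.
by move=> d; exact: (double_ext_mock_lie mockJ1 pseudoJ1 mockJ2 phi_AnDer).
Qed.
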